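(* Let $\mu$ be a nondegenerate Borel probability measure on the kale $\mathcal K$ with $\int_{\mathcal K} d(\mathbf 0,p)\,d\mu(p)<\infty$, and let $(p_n)_{n\ge1}$ be independent $\mathcal K$-valued random variables with distribution $\mu$ on a probability space $(\Omega,\mathcal A,\mathbb P)$. Let $b_N$ be the barycenter of $p_1,\dots,p_N$ and let $\nu_N$ be the distribution of $\sqrt N\,b_N$, i.e. $\nu_N(U)=\mathbb P(\sqrt N\,b_N\in U)$ for Borel sets $U\subset\mathcal K$. If $\mu$ is fully sticky, then the measures $\nu_N$ converge in the total variation norm (and hence weakly) to the point measure $\delta_{\mathbf 0}$ as $N\to\infty$. In particular, for any bounded (Borel measurable) function $\phi:\mathcal K\to\mathbb R$, $$\lim_{N\to\infty}\int_{\mathcal K}\phi(p)\,d\nu_N(p)=\phi(\mathbf 0).$$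
   Context: Fix $\alpha>2\pi$. The kale is $\mathcal K=\big((0,\infty)\times(\mathbb R/\alpha\mathbb Z)\big)\cup\{\mathbf 0\}$; points are written $(r,\theta)$ with $r\ge 0$, $\theta\in\mathbb R/\alpha\mathbb Z$, and $(0,\theta)=\mathbf 0$ for every $\theta$. For angles put $|\theta'-\theta|=\min_{n\in\mathbb Z}|n\alpha+\theta'-\theta|$; when $|\theta'-\theta|\le\pi$, the symbol $\theta'-\theta$ denotes the unique representative in $[-\pi,\pi]$. The metric is $d((r_1,\theta_1),(r_2,\theta_2))^2=(r_1+r_2)^2$ if $|\theta_1-\theta_2|\ge\pi$ and $=r_1^2+r_2^2-2r_1r_2\cos|\theta_1-\theta_2|$ if $|\theta_1-\theta_2|\le\pi$; in particular $d(\mathbf 0,(r,\theta))=r$. Scaling: $\beta(r,\theta)=(\beta r,\theta)$ for $\beta\ge0$. Folding map: $F_\theta:\mathcal K\to\mathbb R^2$ sends $\mathbf 0$ to $0$ and, in polar coordinates on $\mathbb R^2$, $F_\theta(r',\theta')=(r',\theta'-\theta)$ if $r'>0$, $|\theta'-\theta|\le\pi$, and $F_\theta(r',\theta')=(r',\pi)$ if $r'>0$, $|\theta'-\theta|\ge\pi$. The folded first moment is $m_\theta=\int_{\mathcal K}F_\theta(p)\,d\mu(p)=(m_{\theta,1},m_{\theta,2})\in\mathbb R^2$ (cartesian coordinates). The measure $\mu$ is fully sticky if $m_{\theta,1}<0$ for all $\theta\in\mathbb R/\alpha\mathbb Z$. Nondegenerate means: $\mu(R_{\theta,\theta'})<1$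 for all angles $\theta,\theta'$ with $|\theta-\theta'|\ge\pi$, where $R_{\theta,\theta'}=\{(r,\theta):r\ge 0\}\cup\{(r,\theta'):r\ge 0\}$. Barycenter of points: $b_N=\operatorname{arg\,min}_{p\in\mathcal K}\frac1{2N}\sum_{n=1}^N d(p,p_n)^2$ (the minimizer exists and is unique). *)

(* Defs.v *)
From HB Require Import structures.
From mathcomp Require Import all_boot all_order all_algebra finmap.
From mathcomp Require Import generic_quotient ring_quotient.
From mathcomp Require Import all_classical all_reals all_analysis.
From mathcomp Require Import ring lra.

Set Implicit Arguments.
Unset Strict Implicit.
Unset Printing Implicit Defensive.

Import Order.TTheory GRing.Theory Num.Theory.
Import numFieldNormedType.Exports.

Local Open Scope classical_set_scope.
Local Open Scope ring_scope.
Local Open Scope quotient_scope.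

Section Angle.
Context {R : realType} (alpha : R).

Definition periods : {pred R} :=
  fun x => `[< exists n : int, x = n%:~R * alpha >].

Lemma periods_zmod_closed : zmod_closed periods.
Proof.
split => [|x y]; rewrite !unfold_in.
  by apply/asboolP; exists 0; rewrite mul0r.
move=> /asboolP[n ->] /asboolP[m ->]; apply/asboolP; exists (n - m).
by rewrite intrB mulrBl.
Qed.

HB.instance Definition _ :=
  GRing.isZmodClosed.Build R periods periods_zmod_closed.

Definition angle : Type := Quotient.quot (periods : zmodClosed R).

HB.instance Definition _ := GRing.Zmodule.on angle.
HB.instance Definition _ := EqQuotient.on angle.

(* |t|; the infimum is a minimum because the coset of t is closed. *)
Definition angle_norm (t : angle) : R :=
  inf (range (fun n : int => `|n%:~R * alpha + repr t|)).

(* The representative of t in [-pi, pi]: it exists when angle_norm t <= pi and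
   is then unique if 2 * pi < alpha. *)
Definition signed_angle (t : angle) : R :=
  xget 0 [set x | - pi <= x <= pi /\ \pi_angle x = t].

Lemma pi_angleP (x y : R) :
  \pi_angle x = \pi_angle y <-> exists n : int, x - y = n%:~R * alpha.
Proof.
split=> [/eqP|H].
  by rewrite -Quotient.idealrBE unfold_in => /asboolP.
by apply/eqP; rewrite -Quotient.idealrBE unfold_in; apply/asboolP.
Qed.

Lemma angle_coset (t : angle) (x : R) :
  \pi_angle x = t <-> exists n : int, x = n%:~R * alpha + repr t.
Proof.
rewrite -[X in _ = X](reprK t) pi_angleP.
by split=> -[n e]; exists n; [rewrite -e subrK | rewrite e addrK].
Qed.

Lemma angle_normE (t : angle) :
  angle_norm t = inf [set `|x| | x in [set x | \pi_angle x = t]].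
Proof.
rewrite /angle_norm; congr inf; apply/seteqP; split => [_ [n _ <-]|_ [x tx <-]].
  by exists (n%:~R * alpha + repr t) => //=; apply/angle_coset; exists n.
by move/angle_coset: tx => [n ->]; exists n.
Qed.

Lemma angle_norm_le (x : R) : angle_norm (\pi_angle x) <= `|x|.
Proof.
rewrite angle_normE; apply: ge_inf; last by exists x.
by exists 0 => _ [y _ <-].
Qed.

Lemma angle_norm_lb (t : angle) (c : R) :
  (forall x, \pi_angle x = t -> c <= `|x|) -> c <= angle_norm t.
Proof.
move=> H; rewrite angle_normE; apply: lb_le_inf.
  by exists `|repr t|, (repr t) => //=; rewrite reprK.
by move=> _ [x tx <-]; exact: H.
Qed.

Lemma angle_norm_approx (t : angle) (e : R) : 0 < e ->
  exists2 x, \pi_angle x = t & `|x| < angle_norm t + e.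
Proof.
move=> e0; apply: contrapT => H.
suff : angle_norm t + e <= angle_norm t by rewrite gerDl leNgt e0.
by apply: angle_norm_lb => x tx; rewrite leNgt; apply/negP => xe; apply: H; exists x.
Qed.

Lemma angle_norm_ge0 t : 0 <= angle_norm t.
Proof. exact: angle_norm_lb. Qed.

Lemma angle_norm0 : angle_norm 0 = 0.
Proof.
apply/eqP; rewrite eq_le angle_norm_ge0 andbT.
have <- : \pi_angle 0 = 0 :> angle by rewrite raddf0.
by apply: (le_trans (angle_norm_le 0)); rewrite normr0.
Qed.

Lemma angle_normN t : angle_norm (- t) = angle_norm t.
Proof.
suff H u : angle_norm (- u) <= angle_norm u.
  by apply/eqP; rewrite eq_le H -{1}(opprK t) H.
apply: angle_norm_lb => x <-.
by rewrite -raddfN -(normrN x); exact: angle_norm_le.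
Qed.

Lemma angle_normD t u : angle_norm (t + u) <= angle_norm t + angle_norm u.
Proof.
apply/ler_addgt0Pr => e e0.
have e2 : 0 < e / 2 by rewrite divr_gt0.
have [x xt xl] := angle_norm_approx t e2.
have [y yu yl] := angle_norm_approx u e2.
rewrite -xt -yu -raddfD; apply: le_trans (angle_norm_le _) _.
apply: le_trans (ler_normD _ _) _; rewrite xt yu.
by rewrite [X in _ <= _ + X](splitr e) addrACA lerD// ltW.
Qed.

Lemma angle_norm_eq0 t : angle_norm t = 0 -> t = 0.
Proof.
move=> t0.
have H e : 0 < e -> exists2 x, \pi_angle x = t & `|x| < e.
  by move=> e0; have [x xt] := angle_norm_approx t e0; rewrite t0 add0r; exists x.
have [a0|a0] := eqVneq alpha 0.
  rewrite -(reprK t) -[RHS](raddf0 \pi_angle); congr (\pi_angle _).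
  apply/eqP; rewrite -normr_le0; apply/ler_addgt0Pl => e e0; rewrite addr0.
  have [x /angle_coset[n ->]] := H _ e0.
  by rewrite a0 mulr0 add0r => /ltW.
have a2 : 0 < `|alpha| / 2 by rewrite divr_gt0// normr_gt0.
have [x xt xl] := H _ a2.
have [x0|x0] := eqVneq x 0; first by rewrite -xt x0 raddf0.
have m0 : 0 < Num.min (`|alpha| / 2) `|x| by rewrite lt_min a2 normr_gt0.
have [y yt] := H _ m0; rewrite lt_min => /andP[yl yx].
have /pi_angleP[n nE] : \pi_angle x = \pi_angle y by rewrite xt.
have : `|x - y| < `|alpha|.
  by rewrite (splitr `|alpha|) (le_lt_trans (ler_normB _ _))// ltrD.
rewrite nE normrM -[ltRHS]mul1r ltr_pM2r ?normr_gt0//.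
rewrite -intr_norm (_ : 1 = 1%:~R)// ltr_int => n0.
have n00 : n = 0.
  by apply/eqP; rewrite -normr_le0 -ltzD1 add0r.
move: nE; rewrite n00 mul0r => /eqP; rewrite subr_eq0 => /eqP xy.
by rewrite xy ltxx in yx.
Qed.

End Angle.

Section PlaneTriangle.
Context {R : realType}.
Implicit Types r s t a b : R.

Definition chord r s a := Num.sqrt (r ^+ 2 + s ^+ 2 - 2 * r * s * cos a).

Lemma chordE r s a b : r ^+ 2 + s ^+ 2 - 2 * r * s * cos (a - b) =
  (r * cos a - s * cos b) ^+ 2 + (r * sin a - s * sin b) ^+ 2.
Proof.
have -> : r ^+ 2 = r ^+ 2 * (cos a ^+ 2 + sin a ^+ 2).
  by rewrite cos2Dsin2 mulr1.
have -> : s ^+ 2 = s ^+ 2 * (cos b ^+ 2 + sin b ^+ 2).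
  by rewrite cos2Dsin2 mulr1.
rewrite cosB; ring.
Qed.

Lemma chord_sqr_ge0 r s a : 0 <= r ^+ 2 + s ^+ 2 - 2 * r * s * cos a.
Proof. by rewrite -[a]subr0 chordE addr_ge0// sqr_ge0. Qed.

Lemma minkowski2 a b c d :
  Num.sqrt ((a + c) ^+ 2 + (b + d) ^+ 2) <=
  Num.sqrt (a ^+ 2 + b ^+ 2) + Num.sqrt (c ^+ 2 + d ^+ 2).
Proof.
have ge0 (u v : R) : 0 <= u ^+ 2 + v ^+ 2 by rewrite addr_ge0// sqr_ge0.
rewrite -[leRHS]ger0_norm ?addr_ge0 ?sqrtr_ge0// -sqrtr_sqr.
rewrite ler_sqrt ?sqr_ge0// [leRHS]sqrrD !sqr_sqrtr// -sqrtrM//.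
suff : a * c + b * d <= Num.sqrt ((a ^+ 2 + b ^+ 2) * (c ^+ 2 + d ^+ 2)).
  by move=> h; rewrite !sqrrD; move: h; set S := Num.sqrt _; lra.
apply: le_trans (ler_norm _) _; rewrite -sqrtr_sqr ler_sqrt ?mulr_ge0//.
rewrite -subr_ge0 (_ : _ - _ = (a * d - b * c) ^+ 2) ?sqr_ge0//; ring.
Qed.

Lemma chordD r s t a b : chord r t (a + b) <= chord r s a + chord s t b.
Proof.
rewrite /chord.
have -> : cos (a + b) = cos (a - (- b)) by rewrite opprK.
have -> : cos b = cos (0 - (- b)) by rewrite opprK add0r.
have -> : cos a = cos (a - 0) by rewrite subr0.
rewrite !chordE; apply: le_trans _ (minkowski2 _ _ _ _).
by rewrite !addrA !subrK.
Qed.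

Lemma chord_pi r s : 0 <= r -> 0 <= s -> chord r s pi = r + s.
Proof.
move=> r0 s0; rewrite /chord cospi mulrN1 opprK.
rewrite (_ : _ + _ = (r + s) ^+ 2); last by ring.
by rewrite sqrtr_sqr ger0_norm// addr_ge0.
Qed.

Lemma chord0l s a : 0 <= s -> chord 0 s a = s.
Proof. by move=> s0; rewrite /chord mulr0 !mul0r subr0 expr0n add0r sqrtr_sqr ger0_norm. Qed.

Lemma chordC r s a : chord r s a = chord s r a.
Proof. by rewrite /chord; congr Num.sqrt; ring. Qed.

Lemma le_chord r s a b : 0 <= r -> 0 <= s -> 0 <= a -> a <= b -> b <= pi ->
  chord r s a <= chord r s b.
Proof.
move=> r0 s0 a0 ab bpi; rewrite ler_sqrt ?chord_sqr_ge0// lerD2l lerN2.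
rewrite ler_wpM2l ?mulr_ge0//.
move: ab; rewrite le_eqVlt => /predU1P[->//|ab].
by apply/ltW; rewrite ltr_cos// in_itv/= ?a0/= ?bpi ?(ltW (lt_le_trans ab _))// (le_trans a0 (ltW ab)).
Qed.

Lemma le_capped_chord r s t a b c : 0 <= r -> 0 <= s -> 0 <= t ->
  0 <= a -> 0 <= b -> 0 <= c -> c <= a + b ->
  chord r t (Num.min c pi) <=
  chord r s (Num.min a pi) + chord s t (Num.min b pi).
Proof.
move=> r0 s0 t0 a0 b0 c0 cab; have p0 := @pi_ge0 R.
have m0 (x : R) : 0 <= x -> 0 <= Num.min x pi by move=> x0; rewrite le_min x0.
have mp (x : R) : Num.min x pi <= pi by rewrite ge_min lexx orbT.
have [h|h] := leP (Num.min a pi + Num.min b pi) pi.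
  apply: le_trans (chordD _ _ _ _ _); apply: le_chord => //; first exact: m0.
  have [ap|ap] := leP a pi; have [bp|bp] := leP b pi.
  - by rewrite ge_min cab.
  - by apply: le_trans (mp _) _; rewrite lerDr.
  - by apply: le_trans (mp _) _; rewrite lerDl.
  - by apply: le_trans (mp _) _; rewrite lerDr.
apply: (@le_trans _ _ (chord r t pi)); first exact: le_chord (m0 _ c0) (mp _) _.
have -> : chord r t pi = chord r t (Num.min a pi + (pi - Num.min a pi)) by rewrite subrKC.
apply: le_trans (chordD _ s _ _ _) _; rewrite lerD2l.
by apply: le_chord => //; rewrite ?subr_ge0// lerBlDl ltW.
Qed.

Lemma chord_eq0 r s a : 0 <= r -> 0 <= s -> 0 <= a -> a <= pi ->
  chord r s a = 0 -> r = s /\ (r = 0 \/ a = 0).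
Proof.
move=> r0 s0 a0 api /eqP; rewrite sqrtr_eq0 => h.
have e : r ^+ 2 + s ^+ 2 - 2 * r * s * cos a =
   (r - s) ^+ 2 + 2 * r * s * (1 - cos a) by ring.
have u0 : 0 <= 2 * r * s * (1 - cos a).
  by rewrite !mulr_ge0// subr_ge0 cos_le1.
have /eqP : (r - s) ^+ 2 + 2 * r * s * (1 - cos a) = 0.
  by apply/eqP; rewrite eq_le -e h chord_sqr_ge0.
rewrite paddr_eq0 ?sqr_ge0// sqrf_eq0 subr_eq0 => /andP[/eqP rs].
rewrite -{}rs !mulf_eq0 pnatr_eq0/= orbb subr_eq0.
move=> /orP[/eqP|/eqP c1]; split=> //; first by left.
by right; apply: cos_inj; rewrite ?in_itv/= ?a0 ?lexx ?pi_ge0// cos0.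
Qed.

End PlaneTriangle.

Section Kale.
Context {R : realType} (alpha : R).

(* None is the apex. *)
Definition kale : Type := option ({r : R | 0 < r} * angle alpha).

HB.instance Definition _ := Choice.on kale.

Definition apex : kale := None.

HB.instance Definition _ := isPointed.Build kale apex.

(* The point (r, theta) for 0 <= r, with the convention (0, theta) = apex. *)
Definition polar (r : R) (theta : angle alpha) : kale :=
  omap (fun r' => (r', theta)) (insub r).

Definition kale_radius (p : kale) : R := if p is Some (r, _) then val r else 0.

Definition kale_scale (beta : R) (p : kale) : kale :=
  if p is Some (r, theta) then polar (beta * val r) theta else apex.

Definition kale_dist (p q : kale) : R :=
  match p, q with
  | Some (r1, theta1), Some (r2, theta2) =>
      let delta := angle_norm (theta1 - theta2) in
      if pi <= delta then val r1 + val r2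
      else Num.sqrt (val r1 ^+ 2 + val r2 ^+ 2
                     - 2 * val r1 * val r2 * cos delta)
  | _, _ => kale_radius p + kale_radius q
  end.

Let ang (p : kale) : angle alpha := if p is Some (_, theta) then theta else 0.

Lemma kale_radius_ge0 p : 0 <= kale_radius p.
Proof. by case: p => [[[r r0] t]|]//=; exact: ltW. Qed.

Let kale_distE p q : kale_dist p q =
  chord (kale_radius p) (kale_radius q) (Num.min (angle_norm (ang p - ang q)) pi).
Proof.
case: p => [[r1 t1]|]; last first.
  by rewrite chord0l ?kale_radius_ge0//= add0r.
case: q => [[r2 t2]|]; last first.
  by rewrite chordC chord0l ?kale_radius_ge0//= addr0.
have r10 := kale_radius_ge0 (Some (r1, t1)); have r20 := kale_radius_ge0 (Some (r2, t2)).
by rewrite /kale_dist; case: leP => h; rewrite ?chord_pi.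
Qed.

Lemma kale_distxx p : kale_dist p p = 0.
Proof.
rewrite kale_distE subrr angle_norm0 min_l ?pi_ge0// /chord cos0.
by apply/eqP; rewrite sqrtr_eq0; lra.
Qed.

Lemma kale_dist_eq0 p q : kale_dist p q = 0 -> p = q.
Proof.
rewrite kale_distE => /chord_eq0 -[].
- exact: kale_radius_ge0.
- exact: kale_radius_ge0.
- by rewrite le_min angle_norm_ge0 pi_ge0.
- by rewrite ge_min lexx orbT.
case: p q => [[[r r0] t]|] [[[s s0] u]|]//= rs.
- subst r; case=> [s00|/eqP]; first by have := s0; rewrite {1}s00 ltxx.
  case: leP => [_|_]; last by rewrite gt_eqF ?pi_gt0.
  move=> /eqP/angle_norm_eq0/eqP; rewrite subr_eq0 => /eqP ->.
  by congr (Some (_, _)); exact: val_inj.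
- by have := r0; rewrite {1}rs ltxx.
- by have := s0; rewrite -{1}rs ltxx.
Qed.

Lemma kale_dist_sym p q : kale_dist p q = kale_dist q p.
Proof. by rewrite !kale_distE chordC -angle_normN opprB. Qed.

Lemma kale_dist_triangle q p r : kale_dist p r <= kale_dist p q + kale_dist q r.
Proof.
rewrite !kale_distE; apply: le_capped_chord;
  rewrite ?kale_radius_ge0 ?angle_norm_ge0//.
by rewrite -(subrKA (ang q)); exact: angle_normD.
Qed.

HB.instance Definition _ := isMetric.Build R kale
  kale_distxx kale_dist_eq0 kale_dist_sym kale_dist_triangle.

HB.instance Definition _ :=
  @isMeasurable.Build (sigma_display (@open kale)) kale <<s @open kale >>
    (@sigma_algebra0 _ setT open) (@sigma_algebraC _ open)
    (@sigma_algebra_bigcup _ setT open).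

Definition ray (theta : angle alpha) : set kale :=
  [set polar r theta | r in [set r | 0 <= r]].

(* Cartesian coordinates. *)
Definition fold (theta : angle alpha) (p : kale) : R * R :=
  if p is Some (r, theta') then
    let phi := if angle_norm (theta' - theta) <= pi
               then signed_angle (theta' - theta) else pi in
    (val r * cos phi, val r * sin phi)
  else (0, 0).

Definition frechet (N : nat) (p : nat -> kale) (q : kale) : R :=
  (2 * N%:R)^-1 * \sum_(n < N) kale_dist q (p n) ^+ 2.

(* The points are p 0, ..., p N.-1. *)
Definition barycenter (N : nat) (p : nat -> kale) : kale :=
  xget apex [set b | forall q, frechet N p b <= frechet N p q].

Section Measure.
Variable mu : probability kale R.

Definition nondegenerate_measure : Prop := forall theta theta' : angle alpha,
  pi <= angle_norm (theta - theta') ->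
  (mu (ray theta `|` ray theta') < 1)%E.

Definition folded_moment (theta : angle alpha) : R * R :=
  (\int[mu]_p (fold theta p).1, \int[mu]_p (fold theta p).2).

Definition fully_sticky : Prop := forall theta, (folded_moment theta).1 < 0.

End Measure.

End Kale.

Section Probability.
Context d d' (Omega : measurableType d) (T : measurableType d') (R : realType).

Definition mutually_independent (P : probability Omega R)
    (X : nat -> Omega -> T) : Prop :=
  forall (J : {fset nat}) (A : nat -> set T),
    (forall n, n \in J -> measurable (A n)) ->
    P (\bigcap_(n in [set` J]) X n @^-1` A n) =
    (\prod_(n <- J) P (X n @^-1` A n))%E.

Definition tv_norm (nu : {charge set T -> \bar R}) : \bar R :=
  charge_variation (projT2 (cid (projT2 (cid (Hahn_decomposition nu))))) setT.

Definition tv_dist (m1 m2 : {finite_measure set T -> \bar R}) : \bar R :=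
  tv_norm (cadd (charge_of_finite_measure m1)
                (copp (charge_of_finite_measure m2))).

End Probability.

(* Main.v *)
Require Import Defs.
From HB Require Import structures.
From mathcomp Require Import all_boot all_order all_algebra finmap.
From mathcomp Require Import generic_quotient.
From mathcomp Require Import all_classical all_reals all_analysis.
From mathcomp Require Import measurable_realfun ring lra.

(** The function (fold theta p).1 encodes distances:
    d((r, theta), p)^2 = r^2 + |p|^2 - 2 r (fold theta p).1. Hence, on the ray of
    angle theta, the Frechet function of p_1, ..., p_N is a constant plus
    r^2 / 2 - r S_N(theta), where S_N is the empirical folded moment, and b_N is
    the apex if and only if S_N <= 0 on the whole circle. By compactness, full
    stickiness makes the folded moments of mu at most some - e < 0 uniformly in
    theta. Since S_N is Lipschitz in theta with constant the mean of 1 + |p_n|,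
    which is bounded in probability, the weak law of large numbers on a finite
    net of angles gives S_N < 0 everywhere with probability tending to 1. Thus
    nu_N gives the complement of the apex a mass tending to 0, and this mass
    controls both the total variation distance to the Dirac mass and the
    integrals of bounded functions. *)

Set Implicit Arguments.
Unset Strict Implicit.
Unset Printing Implicit Defensive.

Import Order.TTheory GRing.Theory Num.Theory.
Import numFieldNormedType.Exports.

Local Open Scope classical_set_scope.
Local Open Scope ring_scope.

(** * The weak law of large numbers *)

Lemma le_bounded_integrable d (T : measurableType d) (R : realType)
    (mu : {finite_measure set T -> \bar R}) (f : T -> R) (M : R) :
  measurable_fun setT f -> (forall x, `|f x| <= M) ->
  mu.-integrable setT (EFin \o f).
Proof.
move=> mf fM; apply: measurable_bounded_integrable => //.
  by rewrite -ge0_fin_numE// fin_num_measure.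
by exists M; split; [exact: num_real|move=> x Mx y _; exact: le_trans (ltW Mx)].
Qed.

Lemma Rintegral_cst_probability d (T : measurableType d) (R : realType)
    (P : probability T R) (c : R) : \int[P]_x c = c.
Proof.
rewrite Rintegral_cst// [fine _](_ : _ = 1) ?mulr1//.
by rewrite -[RHS]/(fine 1%E); congr fine; exact: probability_setT.
Qed.

(** Independence says that the law of the pair agrees with the product of the two laws on
    rectangles, hence everywhere; Fubini's theorem for the product law then splits the integral. *)
Lemma Rintegral_mul_indep d d1 d2 (Omega : measurableType d)
    (T1 : measurableType d1) (T2 : measurableType d2) (R : realType)
    (P : probability Omega R) (X : {RV P >-> T1}) (Y : {RV P >-> T2})
    (f : T1 -> R) (g : T2 -> R) (M1 M2 : R) :
  (forall A B, measurable A -> measurable B ->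
    P (X @^-1` A `&` Y @^-1` B) = (P (X @^-1` A) * P (Y @^-1` B))%E) ->
  measurable_fun setT f -> (forall x, `|f x| <= M1) ->
  measurable_fun setT g -> (forall x, `|g x| <= M2) ->
  \int[P]_w (f (X w) * g (Y w)) = \int[P]_w f (X w) * \int[P]_w g (Y w).
Proof.
move=> indep mf fM mg gM.
have mX : measurable_fun setT X by [].
have mY : measurable_fun setT Y by [].
pose Z w := (X w, Y w).
have mZ : measurable_fun setT Z by exact: measurable_fun_pair.
pose Z' : {RV P >-> (T1 * T2)%type} := HB.pack Z (isMeasurableFun.Build _ _ _ _ _ mZ).
have XYE := @product_measure_unique _ _ _ _ R (distribution P X) (distribution P Y)
  (distribution P Z') indep.
pose F (z : T1 * T2) := f z.1 * g z.2.
have mF : measurable_fun setT F by apply: measurable_funM; exact: measurableT_comp.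
have FM z : `|F z| <= M1 * M2 by rewrite normrM ler_pM.
have iF : (distribution P X \x distribution P Y)%E.-integrable setT (EFin \o F).
  apply/integrableP; split; first exact/measurable_EFinP.
  rewrite (eq_measure_integral (distribution P Z')); last by move=> A mA _; exact: XYE.
  by have /integrableP[] := @le_bounded_integrable _ _ _ (distribution P Z') _ _ mF FM.
have -> : \int[P]_w (f (X w) * g (Y w)) = fine (\int[distribution P Z']_z (F z)%:E).
  rewrite integral_distribution//; first exact/measurable_EFinP.
  apply: (@le_bounded_integrable _ _ _ P (F \o Z') (M1 * M2)) => [|w]; last exact: FM.
  exact: (measurableT_comp mF mZ).
rewrite -(eq_measure_integral _ (fun A mA _ => XYE A mA)).
rewrite -(integral12_prod_meas1 iF)/=.
have ifX : (distribution P X).-integrable setT (EFin \o f).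
  exact: le_bounded_integrable mf fM.
have igY : (distribution P Y).-integrable setT (EFin \o g).
  exact: le_bounded_integrable mg gM.
have -> : \int[P]_w f (X w) = \int[distribution P X]_x f x.
  rewrite /Rintegral integral_distribution//; first exact/measurable_EFinP.
  apply: (@le_bounded_integrable _ _ _ P (f \o X) M1) => [|w]; last exact: fM.
  exact: (measurableT_comp mf mX).
have -> : \int[P]_w g (Y w) = \int[distribution P Y]_x g x.
  rewrite /Rintegral integral_distribution//; first exact/measurable_EFinP.
  apply: (@le_bounded_integrable _ _ _ P (g \o Y) M2) => [|w]; last exact: gM.
  exact: (measurableT_comp mg mY).
rewrite -(RintegralZr _ measurableT ifX) /Rintegral.
congr fine; apply: eq_integral => x _.
by rewrite EFinM fineK ?(integrable_fin_num measurableT igY)// -integralZl//.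
Qed.

(** Orthogonality kills the cross terms when the square is expanded, so each of the [N] summands
    contributes at most [M ^+ 2]. *)
Lemma Rintegral_sqr_sum_le d (Omega : measurableType d) (R : realType)
    (P : probability Omega R) (Y : nat -> Omega -> R) (M : R) (N : nat) :
  (forall n, measurable_fun setT (Y n)) -> (forall n w, `|Y n w| <= M) ->
  (forall i j, i != j -> \int[P]_w (Y i w * Y j w) = 0) ->
  \int[P]_w (\sum_(n < N) Y n w) ^+ 2 <= N%:R * M ^+ 2.
Proof.
move=> mY YM Y0.
have mS k : measurable_fun setT (fun w => \sum_(n < k) Y n w).
  by apply: measurable_sum.
have SM k w : `|\sum_(n < k) Y n w| <= k%:R * M.
  apply: le_trans (ler_norm_sum _ _ _) _.
  apply: (@le_trans _ _ (\sum_(n < k) M)); first exact: ler_sum.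
  by rewrite sumr_const card_ord mulr_natl.
have iM (f g : Omega -> R) A B : measurable_fun setT f -> (forall x, `|f x| <= A) ->
    measurable_fun setT g -> (forall x, `|g x| <= B) ->
    P.-integrable setT (EFin \o (fun x => f x * g x)).
  move=> mf fA mg gB; apply: (@le_bounded_integrable _ _ _ _ _ (A * B)).
    exact: measurable_funM.
  by move=> x; rewrite normrM ler_pM.
(* A partial sum is orthogonal to every later term; this is the cross term in the induction on
   [N]. *)
have SY k : forall j, (k <= j)%N -> \int[P]_w ((\sum_(n < k) Y n w) * Y j w) = 0.
  elim: k => [|k IH] j kj.
    under eq_Rintegral do rewrite big_ord0 mul0r.
    by rewrite Rintegral_cst// mul0r.
  under eq_Rintegral do rewrite big_ord_recr/= mulrDl.
  rewrite RintegralD//; [|exact: iM (SM k) _ (YM j)|exact: iM (YM k) _ (YM j)].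
  by rewrite IH ?(ltnW kj)// Y0 ?addr0// ltn_eqF.
elim: N => [|N IH].
  under eq_Rintegral do rewrite big_ord0 expr0n.
  by rewrite Rintegral_cst// !mul0r.
under eq_Rintegral do rewrite big_ord_recr/= expr2 mulrDl.
under eq_Rintegral do rewrite !mulrDr [Y N _ * _]mulrC -!expr2.
have i1 := iM _ _ _ _ (mS N) (SM N) (mS N) (SM N).
have i2 := iM _ _ _ _ (mS N) (SM N) (mY N) (YM N).
have i3 := iM _ _ _ _ (mY N) (YM N) (mY N) (YM N).
rewrite !RintegralD//; first last.
  exact: (integrableD measurableT i2 i3).
  exact: (integrableD measurableT i1 i2).
rewrite SY// addr0 add0r -natr1 mulrDl mul1r lerD//.
apply: (@le_trans _ _ (\int[P]_w (M ^+ 2))); last by rewrite Rintegral_cst_probability.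
apply: le_Rintegral => //; first by apply: (@le_bounded_integrable _ _ _ _ _ `|M ^+ 2|).
move=> w _; rewrite -(real_normK (num_real (Y N w))).
by rewrite lerXn2r ?nnegrE ?(le_trans _ (YM N w)).
Qed.

Lemma markov_Rintegral d (T : measurableType d) (R : realType)
    (mu : {measure set T -> \bar R}) (h : T -> R) (a : R) :
  0 < a -> (forall x, 0 <= h x) -> mu.-integrable setT (EFin \o h) ->
  (mu [set x | (a <= h x)%R] <= ((\int[mu]_x h x) / a)%:E)%E.
Proof.
move=> a0 h0 ih; rewrite EFinM lee_pdivlMr// muleC.
have mh : measurable_fun setT (EFin \o h) by case/integrableP: ih.
rewrite fineK ?(integrable_fin_num _ ih)//.
have := @le_integral_comp_abse _ _ _ mu _ measurableT (EFin \o h) a id.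
rewrite setTI => /(_ _ _ _ mh a0).
under eq_integral => x _ do rewrite /= ger0_norm//.
rewrite (_ : [set x | _] = [set x | a <= h x]); last first.
  by apply/seteqP; split=> x /=; rewrite lee_fin ger0_norm.
by apply => //.
Qed.

Lemma measurable_superlevel d (T : measurableType d) (R : realType)
    (h : T -> R) (c : R) :
  measurable_fun setT h -> measurable [set x | c <= h x].
Proof.
by move=> mh; rewrite -preimage_itvcy -[X in measurable X]setTI; exact: mh.
Qed.

Section WeakLaw.
Import HBSimple.
Context d d' (Omega : measurableType d) (T : measurableType d') (R : realType).
Variables (P : probability Omega R) (mu : probability T R).
Variable X : nat -> {RV P >-> T}.
Hypothesis X_indep : mutually_independent P X.
Hypothesis X_law : forall n (A : set T),
  measurable A -> distribution P (X n) A = mu A.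

Let law_integral n (g : T -> \bar R) :
  (\int[distribution P (X n)]_x g x = \int[mu]_x g x)%E.
Proof. by apply: eq_measure_integral => A mA _; exact: X_law. Qed.

Lemma integrable_law n (g : T -> R) : mu.-integrable setT (EFin \o g) ->
  P.-integrable setT (EFin \o (fun w => g (X n w))).
Proof.
case/integrableP => /measurable_EFinP mg ig; apply/integrableP; split.
  by apply/measurable_EFinP; exact: measurableT_comp.
rewrite -(@ge0_integral_distribution _ _ _ _ _ P (X n) (fun x => `|(g x)%:E|%E))//.
  by rewrite law_integral.
by apply/measurable_EFinP; exact: measurableT_comp.
Qed.

Lemma Rintegral_law n (g : T -> R) : mu.-integrable setT (EFin \o g) ->
  \int[P]_w g (X n w) = \int[mu]_x g x.
Proof.
move=> ig; rewrite /Rintegral -(law_integral n) integral_distribution//.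
  by case/integrableP: ig.
exact: integrable_law.
Qed.

Lemma mutually_independent_pair i j A B : i != j ->
  measurable A -> measurable B ->
  P (X i @^-1` A `&` X j @^-1` B) = (P (X i @^-1` A) * P (X j @^-1` B))%E.
Proof.
move=> ij mA mB.
have := @X_indep [fset i; j]%fset (fun n => if n == i then A else B).
rewrite big_fsetU1 ?inE//= big_seq_fset1 eqxx eq_sym (negbTE ij) => <-; last first.
  by move=> n _; case: ifP.
congr (P _); apply/seteqP; split=> w.
  by move=> [wA wB] n /=; rewrite !inE => /orP[]/eqP ->;
    rewrite ?eqxx// eq_sym (negbTE ij).
move=> H; split; first by have := H i; rewrite /= !inE eqxx; apply.
by have := H j; rewrite /= !inE eqxx orbT eq_sym (negbTE ij); apply.
Qed.

(** Chebyshev's inequality: the centred variables [Y n] are bounded by [2 * M] and pairwise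
    uncorrelated, so their sum has second moment at most [N * (2 * M)^2], to be divided by
    [(N * e)^2]. *)
Lemma weak_law_bounded (g : T -> R) (M e : R) (N : nat) :
  measurable_fun setT g -> (forall x, `|g x| <= M) -> 0 < e -> (0 < N)%N ->
  (P [set w | (e <= `|N%:R^-1 * (\sum_(n < N) g (X n w)) - \int[mu]_x g x|)%R ]
    <= (N%:R^-1 * (2 * M / e) ^+ 2)%:E)%E.
Proof.
move=> mg gM e0 N0; set c := \int[mu]_x g x.
have ig : mu.-integrable setT (EFin \o g).
  exact: le_bounded_integrable mg gM.
have N0' : 0 < N%:R :> R by rewrite ltr0n.
pose Y n w := g (X n w) - c.
have cM : `|c| <= M.
  apply: le_trans (le_normr_Rintegral _ _) _ => //.
  apply: (@le_trans _ _ (\int[mu]_x M)).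
    apply: le_Rintegral => //; first exact: integrable_norm.
    exact: (@le_bounded_integrable _ _ _ _ _ `|M|).
  by rewrite Rintegral_cst_probability.
have YM n w : `|Y n w| <= 2 * M.
  by apply: le_trans (ler_normB _ _) _; have := gM (X n w); move: cM; lra.
have mY n : measurable_fun setT (Y n).
  by apply: measurable_funB => //; exact: measurableT_comp.
have Y0 i j : i != j -> \int[P]_w (Y i w * Y j w) = 0.
  move=> ij; pose h x := g x - c.
  have mh : measurable_fun setT h by exact: measurable_funB.
  have hM x : `|h x| <= 2 * M.
    by apply: le_trans (ler_normB _ _) _; have := gM x; move: cM; lra.
  rewrite (@Rintegral_mul_indep _ _ _ _ _ _ _ P (X i) (X j) h h (2 * M) (2 * M))//.
    rewrite Rintegral_law; last exact: le_bounded_integrable hM.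
    rewrite RintegralB//; last by apply: (@le_bounded_integrable _ _ _ _ _ `|c|).
    by rewrite Rintegral_cst_probability subrr mul0r.
  by move=> A B mA mB; exact: mutually_independent_pair.
have mS : measurable_fun setT (fun w => \sum_(n < N) Y n w) by exact: measurable_sum.
have SM w : `|\sum_(n < N) Y n w| <= N%:R * (2 * M).
  apply: le_trans (ler_norm_sum _ _ _) _.
  apply: (@le_trans _ _ (\sum_(n < N) (2 * M))); first exact: ler_sum.
  by rewrite sumr_const card_ord [in leRHS]mulr_natl.
(* The event is multiplied by [N] and squared to take the form that Markov's inequality handles. *)
have Neq : [set w | e <= `|N%:R^-1 * (\sum_(n < N) g (X n w)) - c| ] =
    [set w | (N%:R * e) ^+ 2 <= (\sum_(n < N) Y n w) ^+ 2].
  apply/seteqP; suff H w : (e <= `|N%:R^-1 * (\sum_(n < N) g (X n w)) - c|) =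
      ((N%:R * e) ^+ 2 <= (\sum_(n < N) Y n w) ^+ 2) by split=> w /=; rewrite H.
  have -> : \sum_(n < N) Y n w = N%:R * (N%:R^-1 * (\sum_(n < N) g (X n w)) - c).
    rewrite big_split/= sumr_const card_ord mulrBr mulrA mulfV ?mul1r ?gt_eqF//.
    by rewrite mulNrn mulr_natl.
  rewrite -[X in _ = (_ <= X)]real_normK ?num_real// normrM (ger0_norm (ltW N0')).
  by rewrite ler_sqr ?nnegrE ?mulr_ge0 ?(ltW e0)// ler_pM2l.
rewrite {}Neq; apply: le_trans
  (@markov_Rintegral _ _ _ P (fun w => (\sum_(n < N) Y n w) ^+ 2) _ _ _ _) _.
- by rewrite exprn_gt0// mulr_gt0.
- by move=> w; exact: sqr_ge0.
- apply: (@le_bounded_integrable _ _ _ _ _ ((N%:R * (2 * M)) ^+ 2)).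
    exact: measurable_funX.
  by move=> w; rewrite normrX lerXn2r// nnegrE// (le_trans _ (SM w)).
rewrite lee_fin ler_pdivrMr ?exprn_gt0 ?mulr_gt0//.
apply: le_trans (@Rintegral_sqr_sum_le _ _ _ P Y (2 * M) N mY YM Y0) _.
rewrite le_eqVlt; apply/orP; left; apply/eqP; field.
by rewrite !gt_eqF.
Qed.

(** By linearity the empirical mean of [h] has expectation [\int[mu]_x h x] for every positive [N],
    so Markov's inequality gives a bound uniform in [N]. *)
Lemma markov_mean (h : T -> R) (a : R) (N : nat) :
  mu.-integrable setT (EFin \o h) -> (forall x, 0 <= h x) -> 0 < a -> (0 < N)%N ->
  (P [set w | (a <= N%:R^-1 * (\sum_(n < N) h (X n w)))%R ]
    <= ((\int[mu]_x h x) / a)%:E)%E.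
Proof.
move=> ih h0 a0 N0.
have N0' : 0 < N%:R :> R by rewrite ltr0n.
have iX n : P.-integrable setT (EFin \o (fun w => h (X n w))).
  exact: integrable_law.
have iS k : P.-integrable setT (EFin \o (fun w => \sum_(n < k) h (X n w))).
  rewrite (_ : _ \o _ = fun w => (\sum_(n < k) (h (X n w))%:E)%E); last first.
    by apply/funext => w; rewrite /= sumEFin.
  by apply: integrable_sum => // i _; exact: iX.
have ES k : \int[P]_w (\sum_(n < k) h (X n w)) = k%:R * \int[mu]_x h x.
  elim: k => [|k IH].
    by under eq_Rintegral do rewrite big_ord0; rewrite Rintegral_cst// !mul0r.
  under eq_Rintegral do rewrite big_ord_recr/=.
  rewrite (RintegralD measurableT (iS k) (iX k)) IH Rintegral_law//.
  by rewrite -natr1 mulrDl mul1r.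
apply: le_trans
  (@markov_Rintegral _ _ _ P (fun w => N%:R^-1 * (\sum_(n < N) h (X n w))) _ _ _ _) _.
- exact: a0.
- by move=> w; rewrite mulr_ge0 ?invr_ge0 ?(ltW N0')// sumr_ge0.
- rewrite (_ : _ \o _ = fun w => (N%:R^-1)%:E * (\sum_(n < N) h (X n w))%:E)%E//.
  exact: (integrableZl measurableT _ (iS N)).
by rewrite RintegralZl// ES mulrA mulVf ?mul1r// gt_eqF.
Qed.

(* The summands are only integrable, so f is approximated in L1 by a bounded g:
   Chebyshev's inequality handles g and Markov's inequality handles |f - g|. *)
Lemma weak_law (f : T -> R) (e delta : R) :
  mu.-integrable setT (EFin \o f) -> 0 < e -> 0 < delta ->
  \forall N \near \oo,
    (P [set w | (e <= `|N%:R^-1 * (\sum_(n < N) f (X n w)) - \int[mu]_x f x|)%R ]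
      <= delta%:E)%E.
Proof.
move=> int_f e0 d0.
have e3 : 0 < e / 3 by rewrite divr_gt0.
have [g_ [ig _ gf]] := approximation_sfun_integrable measurableT int_f.
(* The first entry keeps the means of [f] and [g] within [e / 3]; the second makes the Markov bound
   for [|f - g|] at level [e / 3] at most [delta / 2]. *)
pose eta := Num.min (e / 3) (e / 3 * (delta / 2)).
have eta0 : 0 < eta by rewrite lt_min e3 mulr_gt0// divr_gt0.
have [g [int_g gM int_fg]] : exists g : T -> R,
    [/\ mu.-integrable setT (EFin \o g), exists M, forall x, `|g x| <= M &
        \int[mu]_x `|f x - g x| < eta].
  have /fine_cvgP[_ /cvgrPdist_lt/(_ _ eta0)[k _ /(_ k (leqnn k))/=]] := gf.
  rewrite sub0r normrN => kl; exists (g_ k); split => //.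
    have [M [_ mrt]] := simple_bounded (g_ k).
    by exists (M + 1) => x; apply: mrt => //; rewrite ltrDl.
  by apply: le_lt_trans kl; rewrite ler_norm.
have mf : measurable_fun setT f by apply/measurable_EFinP; case/integrableP: int_f.
have mg : measurable_fun setT g by apply/measurable_EFinP; case/integrableP: int_g.
have [M {}gM] := gM.
pose h x := `|f x - g x|.
have int_h : mu.-integrable setT (EFin \o h).
  by apply: integrable_norm; exact: (integrableB measurableT int_f int_g).
have mh : measurable_fun setT h by apply/measurable_EFinP; case/integrableP: int_h.
have fg_mean : `|\int[mu]_x f x - \int[mu]_x g x| <= e / 3.
  rewrite -RintegralB//; apply: le_trans (le_normr_Rintegral _ _) _ => //.
    exact: (integrableB measurableT int_f int_g).
  by apply: ltW; apply: lt_le_trans int_fg _; rewrite ge_min lexx.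
have [K _ HK] : \forall N \near \oo, N%:R^-1 * (2 * M / (e / 3)) ^+ 2 <= delta / 2.
  have : N%:R^-1 * (2 * M / (e / 3)) ^+ 2 @[N --> \oo] --> (0 : R).
    rewrite -[X in _ --> X](mul0r ((2 * M / (e / 3)) ^+ 2)).
    apply: cvgMl; apply/gtr0_cvgV0; last exact: cvgr_idn.
    by near=> n; rewrite ltr0n; near: n; exact: nbhs_infty_gt.
  move=> /cvgrPdist_le/(_ (delta / 2)); rewrite divr_gt0// => /(_ isT).
  apply: filterS => N; rewrite sub0r normrN; exact: le_trans (ler_norm _).
exists K.+1 => // N /= KN; have N0 : (0 < N)%N by exact: leq_trans KN.
have N0' : 0 < N%:R :> R by rewrite ltr0n.
have mS (u : T -> R) : measurable_fun setT u ->
    measurable_fun setT (fun w => N%:R^-1 * (\sum_(n < N) u (X n w))).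
  move=> mu'; apply: measurable_funM => //; apply: measurable_sum => n.
  exact: measurableT_comp.
have mD (u : T -> R) a b : measurable_fun setT u ->
    measurable [set w | a <= `|N%:R^-1 * (\sum_(n < N) u (X n w)) - b| ].
  move=> mu'; apply: measurable_superlevel; apply: measurableT_comp => //.
  by apply: measurable_funB => //; exact: mS.
have mA := mD g (e / 3) (\int[mu]_x g x) mg.
have mB : measurable [set w | e / 3 <= N%:R^-1 * (\sum_(n < N) h (X n w))].
  exact/measurable_superlevel/mS.
apply: le_trans (le_measure P _ _ _) _; rewrite ?inE.
- exact: mD.
- exact: measurableU mA mB.
(* Outside both events the deviation of [f] splits into three terms, two below [e / 3] and one at
   most [e / 3]. *)
- move=> w /= ew; apply: contrapT => /not_orP[/negP + /negP].
  rewrite -!ltNge => Alt Blt; move: ew; apply/negP; rewrite -ltNge.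
  have fgh : `|N%:R^-1 * (\sum_(n < N) f (X n w)) - N%:R^-1 * (\sum_(n < N) g (X n w))|
      <= N%:R^-1 * (\sum_(n < N) h (X n w)).
    rewrite -mulrBr normrM ger0_norm ?invr_ge0 ?(ltW N0')//.
    rewrite ler_wpM2l ?invr_ge0 ?(ltW N0')// -sumrB; exact: ler_norm_sum.
  have -> : N%:R^-1 * (\sum_(n < N) f (X n w)) - \int[mu]_x f x =
    (N%:R^-1 * (\sum_(n < N) f (X n w)) - N%:R^-1 * (\sum_(n < N) g (X n w))) +
    (N%:R^-1 * (\sum_(n < N) g (X n w)) - \int[mu]_x g x) -
    (\int[mu]_x f x - \int[mu]_x g x) by ring.
  apply: le_lt_trans (ler_normB _ _) _.
  have -> : e = e / 3 + e / 3 + e / 3 by field.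
  apply: ltr_leD fg_mean; apply: le_lt_trans (ler_normD _ _) _.
  by apply: ltrD => //; apply: le_lt_trans fgh _.
apply: le_trans (measureU2 _ mA mB) _.
rewrite [delta]splitr EFinD; apply: leeD.
  apply: le_trans (weak_law_bounded mg gM e3 N0) _.
  by rewrite lee_fin; apply: HK; exact: ltnW.
apply: le_trans (markov_mean int_h _ e3 N0) _; first by move=> x; exact: normr_ge0.
rewrite lee_fin ler_pdivrMr// mulrC.
by apply: ltW; apply: lt_le_trans int_fg _; rewrite ge_min lexx orbT.
Unshelve. all: by end_near.
Qed.

End WeakLaw.

(** * Geometry of the kale *)

Section KaleGeometry.
Local Open Scope quotient_scope.
Context {R : realType} (alpha : R).
Hypothesis alpha_gt : 2 * pi < alpha.
Implicit Types (theta : angle alpha) (p q : kale alpha).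

Let alpha0 : 0 < alpha.
Proof. by apply: lt_trans alpha_gt; rewrite mulr_gt0// pi_gt0. Qed.

(** Two distinct representatives differ by at least [alpha], so one of absolute value at most
    [alpha / 2] realizes [angle_norm t]. Since [pi < alpha / 2], this applies to the signed angle,
    and the cosine ignores its sign. *)
Lemma cos_signed_angle (t : angle alpha) :
  angle_norm t <= pi -> cos (signed_angle t) = cos (angle_norm t).
Proof.
move=> tpi.
have minimal (x y : R) : \pi_(angle alpha) x = t -> \pi_(angle alpha) y = t ->
    `|x| <= alpha / 2 -> `|x| <= `|y|.
  move=> xt yt xa; have [<-//|xy] := eqVneq x y.
  have /pi_angleP[n nE] : \pi_(angle alpha) x = \pi_(angle alpha) y by rewrite xt.
  have n1 : 1 <= `|n|%:~R :> R.
    rewrite -[1]/(1%:~R) ler_int -gtz0_ge1 normr_gt0; apply: contra_neq xy => n0.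
    by apply/eqP; rewrite -subr_eq0 nE n0 mul0r.
  have : alpha <= `|x - y|.
    by rewrite nE normrM (gtr0_norm alpha0) ler_peMl ?(ltW alpha0)// -intr_norm.
  by have := ler_normB x y; move: xa; lra.
have normE x : \pi_(angle alpha) x = t -> `|x| <= alpha / 2 -> angle_norm t = `|x|.
  move=> xt xa; apply/eqP; rewrite eq_le -{1}xt angle_norm_le/=.
  by apply: angle_norm_lb => y yt; exact: minimal.
have e0 : 0 < alpha / 2 - pi by move: alpha_gt; lra.
have [x xt xl] := angle_norm_approx t e0.
have xa : `|x| <= alpha / 2 by move: tpi xl; lra.
(* The default value of [xget] does not occur, because [x] itself lies in [[-pi, pi]]. *)
rewrite /signed_angle; case: xgetP => [y _ [/andP[y1 y2] yt]|/(_ x)/= []]; last first.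
  by split=> //; rewrite -ler_norml -(normE x).
rewrite (normE y yt) ?cos_norm//.
apply: (@le_trans _ _ pi); first by rewrite ler_norml y1.
by move: alpha_gt; lra.
Qed.

Lemma fold_fst theta r (r0 : 0 < r) theta' :
  (fold theta (Some (exist _ r r0, theta'))).1 =
  r * cos (Num.min (angle_norm (theta' - theta)) pi).
Proof. by rewrite /=; case: leP => // h; rewrite cos_signed_angle. Qed.

Lemma normr_fold_fst_le theta p : `|(fold theta p).1| <= kale_radius p.
Proof.
case: p => [[[r r0] t]|]; last by rewrite normr0.
rewrite fold_fst normrM gtr0_norm// ler_piMr ?(ltW r0)//.
by rewrite ler_norml cos_geN1 cos_le1.
Qed.

Lemma polar_gt0 r (r0 : 0 < r) theta : polar r theta = Some (exist _ r r0, theta).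
Proof. by rewrite /polar insubT. Qed.

Lemma polar0 theta : polar 0 theta = apex alpha.
Proof. by rewrite /polar insubF// ltxx. Qed.

(** This is the law of cosines; when the angle is at least [pi] it is capped at [pi], where the
    formula gives the square of the sum of the radii. *)
Lemma sqr_kale_dist_polar r theta p : 0 <= r ->
  kale_dist (polar r theta) p ^+ 2 =
  r ^+ 2 + kale_radius p ^+ 2 - 2 * r * (fold theta p).1.
Proof.
rewrite le_eqVlt => /predU1P[<-|r0].
  by rewrite polar0 /= expr0n mulr0 mul0r subr0 !add0r; case: p => [[]|].
rewrite (polar_gt0 r0); case: p => [[[s s0] t]|]; last first.
  by rewrite /= addr0 expr0n mulr0 addr0 subr0.
rewrite fold_fst /= -[angle_norm (theta - t)]angle_normN opprB.
case: leP => h; first by rewrite cospi; ring.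
by rewrite sqr_sqrtr ?chord_sqr_ge0// !mulrA.
Qed.

(** Expressed through distances, the folded coordinate inherits its measurability and its regularity
    in [theta] from the metric. *)
Lemma fold_fstE theta p : (fold theta p).1 =
  (1 + kale_radius p ^+ 2 - kale_dist (polar 1 theta) p ^+ 2) / 2.
Proof. by rewrite sqr_kale_dist_polar//; field. Qed.

Lemma kale_radiusE p : kale_radius p = kale_dist (apex alpha) p.
Proof. by case: p => [[r t]|]; rewrite /= add0r. Qed.

Lemma kale_radius_polar r theta : 0 <= r -> kale_radius (polar r theta) = r.
Proof.
rewrite le_eqVlt => /predU1P[<-|r0]; first by rewrite polar0.
by rewrite (polar_gt0 r0).
Qed.

Lemma fold_fst_dist_le theta theta' p :
  `|(fold theta p).1 - (fold theta' p).1| <=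
  kale_dist (polar 1 theta) (polar 1 theta') * (1 + kale_radius p).
Proof.
set q := polar 1 theta; set q' := polar 1 theta'.
have d1 : kale_dist q p <= 1 + kale_radius p.
  apply: le_trans (kale_dist_triangle (apex alpha) _ _) _.
  by rewrite -kale_radiusE kale_dist_sym -kale_radiusE kale_radius_polar.
have d2 : kale_dist q' p <= 1 + kale_radius p.
  apply: le_trans (kale_dist_triangle (apex alpha) _ _) _.
  by rewrite -kale_radiusE kale_dist_sym -kale_radiusE kale_radius_polar.
have t1 := kale_dist_triangle q' q p.
have := kale_dist_triangle q q' p; rewrite (kale_dist_sym q' q) => t2.
have ge0 (u v : kale alpha) : 0 <= kale_dist u v by exact: (@mdist_ge0 _ (kale alpha)).
(* A difference of squares: the triangle inequality bounds the first factor by the distance of [q]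
   and [q'], the second by [1 + kale_radius p]. *)
have -> : (fold theta p).1 - (fold theta' p).1 =
    (kale_dist q' p - kale_dist q p) * ((kale_dist q' p + kale_dist q p) / 2).
  by rewrite !fold_fstE -/q -/q'; field.
rewrite normrM [X in _ * X <= _]ger0_norm ?divr_ge0 ?addr_ge0//.
apply: ler_pM => //; first by rewrite divr_ge0// addr_ge0.
  by rewrite ler_norml; move: t1 t2; lra.
by move: d1 d2; lra.
Qed.

Lemma continuous_kale_dist q : continuous (kale_dist q).
Proof.
move=> p; apply/(@cvgrPdist_lt _ _ (kale alpha) (nbhs p) (nbhs_filter p)) => e e0.
apply/(@nbhs_ballP _ (kale alpha)); exists e => //= p'; rewrite ballEmdist/= => pp'.
have := kale_dist_triangle p q p'; have := kale_dist_triangle p' q p.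
have : kale_dist p p' < e by [].
by rewrite (kale_dist_sym p' p) ltr_norml; lra.
Qed.

Lemma continuous_kale_measurable (f : kale alpha -> R) :
  continuous f -> measurable_fun setT f.
Proof.
move=> /continuousP cf; apply: (measurability _ (RGenOpens.measurableE R)).
move=> _ [_ [a [b ->] <-]]; rewrite setTI; apply: sub_sigma_algebra.
exact/cf/interval_open.
Qed.

Lemma measurable_kale_dist q : measurable_fun setT (kale_dist q).
Proof. by apply: continuous_kale_measurable; exact: continuous_kale_dist. Qed.

Lemma measurable_kale_radius : measurable_fun setT (@kale_radius R alpha).
Proof.
rewrite (funext kale_radiusE); exact: measurable_kale_dist.
Qed.

Lemma measurable_fold_fst theta : measurable_fun setT (fun p => (fold theta p).1).
Proof.
rewrite (_ : (fun p => _) = fun p =>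
    (1 + kale_radius p ^+ 2 - kale_dist (polar 1 theta) p ^+ 2) / 2).
  apply: measurable_funM => //; apply: measurable_funB.
    apply: measurable_funD => //.
    by apply: measurable_funX; exact: measurable_kale_radius.
  by apply: measurable_funX; exact: measurable_kale_dist.
by apply/funext => p; rewrite fold_fstE.
Qed.

(** At angular distance [a < pi], two unit points have squared distance [2 * (1 - cos a)], so
    continuity of the cosine at 0 gives a uniform modulus. *)
Lemma kale_dist_unit_circle (e : R) : 0 < e -> exists2 eta, 0 < eta &
  forall x y : R, `|x - y| < eta ->
    kale_dist (polar 1 (\pi_(angle alpha) x)) (polar 1 (\pi_(angle alpha) y)) < e.
Proof.
move=> e0; have e2 : 0 < e ^+ 2 / 2 by rewrite divr_gt0// exprn_gt0.
have /cvgrPdist_lt/(_ _ e2)/nbhs_ballP[eta /= eta0 cosP] := @continuous_cos R 0.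
exists (Num.min eta pi) => [|x y]; first by rewrite lt_min eta0 pi_gt0.
rewrite lt_min => /andP[xeta xpi].
rewrite !(polar_gt0 ltr01)/= -raddfB.
have nxy := angle_norm_le alpha (x - y).
rewrite leNgt (le_lt_trans nxy xpi)/=.
have n0 : 0 <= angle_norm (\pi_(angle alpha) (x - y)) by exact: angle_norm_ge0.
have /cosP : ball 0 eta (angle_norm (\pi_(angle alpha) (x - y))).
  by rewrite -ball_normE/= sub0r normrN ger0_norm//; exact: le_lt_trans xeta.
rewrite cos0 => /(le_lt_trans (ler_norm _)) cose.
rewrite -[ltRHS](gtr0_norm e0) -sqrtr_sqr ltr_sqrt ?exprn_gt0//.
by rewrite expr1n mulr1; move: cose; lra.
Qed.

Lemma angle_reprP theta : exists2 x, x \in `[0, alpha] & \pi_(angle alpha) x = theta.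
Proof.
pose n := Num.floor (repr theta / alpha).
exists (repr theta - n%:~R * alpha); last first.
  by apply/angle_coset; exists (- n); rewrite mulrNz mulNr addrC.
have /andP[n1 n2] := floor_itv (repr theta / alpha).
rewrite in_itv/= subr_ge0 -ler_pdivlMr// n1/= lerBlDl ltW//.
by rewrite -[X in _ + X]mul1r -mulrDl -ltr_pdivrMr// -[1]/(1%:~R) -intrD.
Qed.

End KaleGeometry.

(** * Minimizers of the Frechet function *)

Section Barycenter.
Local Open Scope quotient_scope.
Context {R : realType} (alpha : R).
Hypothesis alpha_gt : 2 * pi < alpha.
Implicit Types (theta : angle alpha) (p q : kale alpha).

Lemma lipschitz_unit_circle_continuous (f : R -> R) (C : R) :
  (forall x y, `|f x - f y| <= kale_dist (polar 1 (\pi_(angle alpha) x))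
                                  (polar 1 (\pi_(angle alpha) y)) * C) ->
  continuous f.
Proof.
move=> fC x; apply/cvgrPdist_lt => e e0.
have C0 : 0 < 1 + `|C| by rewrite ltr_pwDl.
have e1 : 0 < e / (1 + `|C|) by rewrite divr_gt0.
have [eta eta0 etaP] := kale_dist_unit_circle alpha e1.
apply/nbhs_ballP; exists eta => // y xy.
apply: le_lt_trans (fC x y) _; apply: (@le_lt_trans _ _ (kale_dist
  (polar 1 (\pi_(angle alpha) x)) (polar 1 (\pi_(angle alpha) y)) * (1 + `|C|))).
  rewrite ler_wpM2l ?(@mdist_ge0 _ (kale alpha))//.
  by apply: le_trans (ler_norm _) _; rewrite lerDr.
by rewrite -ltr_pdivlMr//; exact: etaP.
Qed.

(** The circle is the image of the compact interval [[0, alpha]], along which [f] becomes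
    continuous, so the extreme value theorem applies. *)
Lemma attains_max_angle (f : angle alpha -> R) (C : R) :
  (forall theta theta',
     `|f theta - f theta'| <= kale_dist (polar 1 theta) (polar 1 theta') * C) ->
  exists theta0, forall theta, f theta <= f theta0.
Proof.
move=> fC.
have cf : continuous (fun x => f (\pi_(angle alpha) x)).
  by apply: (@lipschitz_unit_circle_continuous _ C) => x y; exact: fC.
have a0 : 0 <= alpha by move: alpha_gt (@pi_gt0 R); lra.
have [c _ cmax] := EVT_max a0 (continuous_subspaceT cf).
exists (\pi_(angle alpha) c) => theta.
by have [x xa <-] := angle_reprP alpha_gt theta; exact: cmax.
Qed.

Lemma sum_fold_fst_dist_le (N : nat) (p : nat -> kale alpha) theta theta' :
  `|\sum_(n < N) (fold theta (p n)).1 - \sum_(n < N) (fold theta' (p n)).1| <=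
  kale_dist (polar 1 theta) (polar 1 theta') *
    \sum_(n < N) (1 + kale_radius (p n)).
Proof.
rewrite -sumrB mulr_sumr; apply: le_trans (ler_norm_sum _ _ _) _.
by apply: ler_sum => n _; exact: fold_fst_dist_le.
Qed.

Lemma frechet_polar (N : nat) (p : nat -> kale alpha) r theta : (0 < N)%N -> 0 <= r ->
  frechet N p (polar r theta) = frechet N p (apex alpha) + r ^+ 2 / 2
    - r * (N%:R^-1 * \sum_(n < N) (fold theta (p n)).1).
Proof.
move=> N0 r0; have N0' : N%:R != 0 :> R by rewrite pnatr_eq0 -lt0n.
rewrite /frechet.
under eq_bigr do rewrite sqr_kale_dist_polar//.
under [in RHS]eq_bigr do rewrite -kale_radiusE.
rewrite sumrB big_split/= sumr_const card_ord -mulr_sumr -mulr_natl.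
by field.
Qed.

(** On each ray the function is a quadratic in [r], so one maximizes the slope over the angle first
    and then minimizes over the radius. *)
Lemma frechet_has_min (N : nat) (p : nat -> kale alpha) : (0 < N)%N ->
  exists b, forall q, frechet N p b <= frechet N p q.
Proof.
move=> N0; have N0' : 0 < N%:R :> R by rewrite ltr0n.
pose S theta := N%:R^-1 * \sum_(n < N) (fold theta (p n)).1.
have [t0 t0max] := attains_max_angle (sum_fold_fst_dist_le N p).
(* [M] minimizes [r ^+ 2 / 2 - r * S t0] over [0 <= r]; a negative slope puts the minimizer at the
   apex. *)
pose M := Num.max 0 (S t0).
have M0 : 0 <= M by rewrite le_max lexx.
exists (polar M t0) => q.
have -> : frechet N p (polar M t0) = frechet N p (apex alpha) - M ^+ 2 / 2.
  rewrite frechet_polar// -/(S t0) /M; case: leP => _; first by field.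
  by field.
case: q => [[[r r0] t]|]; last by rewrite gerBl divr_ge0// sqr_ge0.
rewrite -(polar_gt0 r0) frechet_polar ?(ltW r0)// -/(S t).
have : S t <= M.
  by rewrite le_max ler_wpM2l ?orbT ?invr_ge0 ?(ltW N0')// t0max.
have := sqr_ge0 (r - M); move: r0; rewrite sqrrD; nra.
Qed.

Lemma barycenter_apexP (N : nat) (p : nat -> kale alpha) : (0 < N)%N ->
  barycenter N p = apex alpha <->
  forall theta, \sum_(n < N) (fold theta (p n)).1 <= 0.
Proof.
move=> N0; have N0' : 0 < N%:R :> R by rewrite ltr0n.
have [b bmin] := frechet_has_min p N0.
(* Existence of a minimizer rules out the default value [apex] in the definition of [barycenter]. *)
have Smin : forall q, frechet N p (barycenter N p) <= frechet N p q.
  rewrite /barycenter; case: xgetP => [y _ //|/(_ b)/(_ bmin) []].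
split=> [bE theta|S0].
  rewrite leNgt; apply/negP => S0.
  (* Moving from the apex to radius [s] along [theta] lowers the Frechet function by
     [s ^+ 2 / 2]. *)
  pose s := N%:R^-1 * \sum_(n < N) (fold theta (p n)).1.
  have s0 : 0 < s by rewrite mulr_gt0// invr_gt0.
  have := Smin (polar s theta); rewrite bE frechet_polar ?(ltW s0)// -/s.
  by apply/negP; rewrite -ltNge; nra.
case: (barycenter N p) Smin => [[[r r0] t]|//] /(_ (apex alpha)).
rewrite -(polar_gt0 r0) frechet_polar ?(ltW r0)// => H; exfalso.
have s0 : N%:R^-1 * \sum_(n < N) (fold t (p n)).1 <= 0.
  by rewrite mulr_ge0_le0// invr_ge0 ltW.
by move: H; apply/negP; rewrite -ltNge; nra.
Qed.

Lemma kale_scale_eq_apex (beta : R) p : 0 < beta ->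
  (kale_scale beta p = apex alpha) <-> (p = apex alpha).
Proof.
move=> b0; case: p => [[[r r0] t]|]//; split => //.
by rewrite /= (polar_gt0 (mulr_gt0 b0 r0)).
Qed.

End Barycenter.

(** * Stickiness *)

Section PointMass.
Context d (T : measurableType d) (R : realType).
Variables (t : T) (m : probability T R).
Hypothesis mt : measurable [set t].

Lemma tv_dist_dirac_le : (tv_dist m \d_t <= 2%:E * m (~` [set t]))%E.
Proof.
have mtC : measurable (~` [set t]) by exact: measurableC.
pose nu := cadd (charge_of_finite_measure m) (copp (charge_of_finite_measure \d_t)).
have nu_le A : measurable A -> (`|nu A| <= m (~` [set t]))%E.
  move=> mA; rewrite (_ : nu A = m A - \d_t A)%E// diracE.
  (* If [A] contains [t], the difference is minus the mass of the complement of [A], which misses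
     [t]; otherwise it is the mass of [A], which misses [t]. *)
  have [tA|tA] := boolP (t \in A).
    have -> : (m A - 1%:E = - m (~` A))%E.
      by rewrite probability_setC// oppeB ?fin_num_adde_defr// addeC.
    rewrite abseN gee0_abs//; apply: le_measure; rewrite ?inE//; first exact: measurableC.
    by apply: subsetC => _ ->; rewrite inE in tA.
  rewrite sube0 gee0_abs//; apply: le_measure; rewrite ?inE//.
  by move=> x Ax /= xt; move: tA; rewrite -xt notin_setE; apply.
(* [tv_norm] uses a Hahn decomposition picked by choice, so the bound is proved for all of them;
   each half contributes one copy of the mass. *)
suff variation_le (A N : set T) (AN : hahn_decomposition nu A N) :
    (charge_variation AN setT <= 2%:E * m (~` [set t]))%E by exact: variation_le.
have [[mA _] [mN _] _ _] := AN.
rewrite /charge_variation jordan_posE jordan_negE cjordan_posE cjordan_negE.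
rewrite /crestr0 mem_set// /crestr !setTI.
rewrite (_ : 2%:E = 1 + 1)%E// ge0_muleDl// mul1e.
apply: leeD; first by apply: le_trans (nu_le _ mA); exact: lee_abs.
by apply: le_trans (nu_le _ mN); rewrite -abseN; exact: lee_abs.
Qed.

(** The integrand [phi t - phi x] vanishes at [t] and is at most [2 * B] in absolute value
    elsewhere. *)
Lemma Rintegral_point_mass_le (phi : T -> R) (B : R) :
  measurable_fun setT phi -> (forall x, `|phi x| <= B) ->
  `|phi t - \int[m]_x phi x| <= 2 * B * fine (m (~` [set t])).
Proof.
move=> mphi phiB; have mtC : measurable (~` [set t]) by exact: measurableC.
have iphi : m.-integrable setT (EFin \o phi) by exact: le_bounded_integrable mphi phiB.
have icst c : m.-integrable setT (EFin \o (fun _ : T => c)).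
  by apply: (@le_bounded_integrable _ _ _ _ _ `|c|).
have -> : phi t - \int[m]_x phi x = \int[m]_x (phi t - phi x).
  by rewrite RintegralB// Rintegral_cst_probability.
have iphit : m.-integrable setT (EFin \o (fun x => phi t - phi x)).
  exact: (integrableB measurableT (icst _) iphi).
apply: le_trans (le_normr_Rintegral _ iphit) _ => //.
have iI : m.-integrable setT (EFin \o (\1_(~` [set t]) : T -> R)).
  exact: integrable_indic.
apply: (@le_trans _ _ (\int[m]_x (2 * B * \1_(~` [set t]) x))).
  apply: le_Rintegral => //.
  - exact: integrable_norm.
  - rewrite (_ : _ \o _ = fun x => (2 * B)%:E * (\1_(~` [set t]) x)%:E)%E//.
    exact: (integrableZl measurableT _ iI).
  move=> x _; rewrite indicE in_setC in_set1.
  have [->|_] := eqVneq x t; first by rewrite subrr normr0 mulr0.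
  rewrite mulr1; apply: le_trans (ler_normB _ _) _.
  by have := phiB x; have := phiB t; lra.
by rewrite RintegralZl// /Rintegral integral_indic// setIT.
Qed.

End PointMass.

(** * Negativity of the empirical folded moments *)

Section Sticky.
Local Open Scope quotient_scope.
Context {R : realType} (alpha : R).
Hypothesis alpha_gt : 2 * pi < alpha.
Implicit Types (theta : angle alpha).

Lemma measurable_apex : measurable [set apex alpha].
Proof.
rewrite (_ : [set _] = ~` [set q | 0 < kale_radius q]).
  apply: measurableC; rewrite -preimage_itvoy -[X in measurable X]setTI.
  exact: measurable_kale_radius.
apply/seteqP; split => [_ -> /=|]; first by rewrite ltxx.
by case=> [[[r r0] t]|]//= /(_ r0).
Qed.

Variable mu : probability (kale alpha) R.
Hypothesis mu_moment : (\int[mu]_q (kale_dist (apex alpha) q)%:E < +oo)%E.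

Lemma integrable_kale_radius : mu.-integrable setT (EFin \o @kale_radius R alpha).
Proof.
apply/integrableP; split; first by apply/measurable_EFinP; exact: measurable_kale_radius.
apply: le_lt_trans mu_moment; rewrite le_eqVlt; apply/orP; left; apply/eqP.
apply: eq_integral => q _.
by rewrite -kale_radiusE /= ger0_norm// kale_radius_ge0.
Qed.

Lemma integrable_1Dkale_radius :
  mu.-integrable setT (EFin \o (fun q => 1 + @kale_radius R alpha q)).
Proof.
have i1 : mu.-integrable setT (EFin \o (fun=> 1 : R)).
  by apply: (@le_bounded_integrable _ _ _ _ _ 1) => // x; rewrite normr1.
exact: (integrableD measurableT i1 integrable_kale_radius).
Qed.

Lemma integrable_fold_fst theta :
  mu.-integrable setT (EFin \o (fun q => (fold theta q).1)).
Proof.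
apply: le_integrable integrable_kale_radius => //.
  by apply/measurable_EFinP; exact: measurable_fold_fst.
move=> q _; rewrite /= lee_fin (ger0_norm (kale_radius_ge0 q)).
exact: normr_fold_fst_le.
Qed.

Lemma folded_moment_dist_le theta theta' :
  `|(folded_moment mu theta).1 - (folded_moment mu theta').1| <=
  kale_dist (polar 1 theta) (polar 1 theta') *
    \int[mu]_q (1 + kale_radius q).
Proof.
have i1 := integrable_fold_fst theta; have i2 := integrable_fold_fst theta'.
have i12 := integrableB measurableT i1 i2.
rewrite /= -RintegralB//; apply: le_trans (le_normr_Rintegral _ i12) _ => //.
rewrite -RintegralZl//; last exact: integrable_1Dkale_radius.
apply: le_Rintegral => //.
- exact: (integrable_norm i12).
- rewrite (_ : _ \o _ = fun q => (kale_dist (polar 1 theta) (polar 1 theta'))%:E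
    * (EFin \o (fun q => 1 + kale_radius q)%R) q)%E//.
  exact: (integrableZl measurableT _ integrable_1Dkale_radius).
- by move=> q _; exact: fold_fst_dist_le.
Qed.

(** The folded moment is Lipschitz in the angle, so it attains its maximum, which is negative by
    stickiness. *)
Lemma fully_sticky_uniform : fully_sticky mu ->
  exists2 e, 0 < e & forall theta, (folded_moment mu theta).1 <= - e.
Proof.
move=> sticky; have [t tmax] := attains_max_angle alpha_gt folded_moment_dist_le.
by exists (- (folded_moment mu t).1) => [|theta]; rewrite ?oppr_gt0// opprK tmax.
Qed.

Lemma finite_net_circle (e : R) : 0 < e ->
  exists (K : nat) (t : nat -> angle alpha), forall theta,
    exists2 i, (i < K)%N & kale_dist (polar 1 theta) (polar 1 (t i)) < e.
Proof.
move=> /(kale_dist_unit_circle alpha)[eta eta0 etaP].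
pose K := Num.trunc (alpha / eta).
exists K.+1, (fun i => \pi_(angle alpha) (i%:R * eta)) => theta.
have [x + <-] := angle_reprP alpha_gt theta; rewrite in_itv/= => /andP[x0 xa].
have q0 : 0 <= x / eta by rewrite divr_ge0// ltW.
have iK : (Num.trunc (x / eta) < K.+1)%N.
  by rewrite ltnS le_truncn// ler_pM2r ?invr_gt0.
exists (Num.trunc (x / eta)) => //; apply: etaP => /=.
have /andP[h1 h2] := truncn_itv q0.
move: h1 h2; rewrite ler_pdivlMr// ltr_pdivrMr// -natr1 mulrDl mul1r => h1 h2.
by rewrite ltr_norml; move: h1 h2 eta0; lra.
Qed.

Context d (Omega : measurableType d) (P : probability Omega R).
Variable p : nat -> {RV P >-> kale alpha}.

Let S N theta w := \sum_(n < N) (fold theta (p n w)).1.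

Lemma measurable_sum_fold_fst N theta : measurable_fun setT (S N theta).
Proof.
apply: measurable_sum => n.
by apply: (measurableT_comp (measurable_fold_fst alpha_gt theta)).
Qed.

(* The value of P on a nonmeasurable set is unspecified, so this event must be
   shown measurable; by continuity, rational angles suffice. *)
Lemma measurable_all_folded_le0 N :
  measurable [set w | forall theta, S N theta w <= 0].
Proof.
rewrite (_ : mkset _ =
    ~` \bigcup_(q : rat) [set w | 0 < S N (\pi_(angle alpha) (ratr q)) w]).
  apply: measurableC; apply: bigcupT_measurable_rat => q.
  rewrite -preimage_itvoy -[X in measurable X]setTI.
  exact: measurable_sum_fold_fst.
apply/seteqP; split => [w /= H [q _ /=]|w /= H theta].
  by rewrite ltNge H.
rewrite leNgt; apply/negP => S0; apply: H.
have [x _ xE] := angle_reprP alpha_gt theta.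
have cS : continuous (fun x => S N (\pi_(angle alpha) x) w).
  apply: (@lipschitz_unit_circle_continuous _ alpha _
    (\sum_(n < N) (1 + kale_radius (p n w)))) => a b.
  exact: (sum_fold_fst_dist_le alpha_gt N (fun n => p n w)).
have /cvgrPdist_lt/(_ _ S0)/nbhs_ballP[eta /= eta0 etaP] := cS x.
have xeta : x - eta < x + eta by rewrite ltrBlDr -addrA ltrDl addr_gt0.
have [q] := rat_in_itvoo xeta; rewrite in_itv/= => /andP[q1 q2].
exists q => //=; have /etaP : ball x eta (ratr q).
  by rewrite -ball_normE/= ltr_norml; move: q1 q2; lra.
by rewrite xE /= => /(le_lt_trans (ler_norm _)); rewrite ltrBlDr ltrDl.
Qed.

Hypothesis p_indep : mutually_independent P p.
Hypothesis p_law : forall (n : nat) (A : set (kale alpha)),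
  measurable A -> distribution P (p n) A = mu A.
Hypothesis mu_sticky : fully_sticky mu.

Lemma sticky_probability (delta : R) : 0 < delta ->
  \forall N \near \oo,
    (P (~` [set w | forall theta, (S N theta w <= 0)%R]) <= delta%:E)%E.
Proof.
move=> d0; have d2 : 0 < delta / 2 by rewrite divr_gt0.
have [e e0 sticky] := fully_sticky_uniform mu_sticky.
have e2 : 0 < e / 2 by rewrite divr_gt0.
pose C := \int[mu]_q (1 + kale_radius q).
have C0 : 0 <= C.
  by apply: Rintegral_ge0 => q _; rewrite addr_ge0// kale_radius_ge0.
(* Markov's inequality bounds the probability that the mean of [1 + |p_n|] reaches [L] by [C / L],
   which is at most [delta / 2]; the summand 1 keeps [L] positive. *)
pose L := (1 + C) / (delta / 2).
have L0 : 0 < L by rewrite divr_gt0// ltr_pwDl.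
(* With Lipschitz constant below [L], a net of mesh [e / 2 / L] costs at most [e / 2] when passing
   to a net point. *)
have [K [t tP]] := finite_net_circle (divr_gt0 e2 L0).
(* The other [delta / 2] is shared among the [K] net points; [K.+1] avoids division by zero. *)
have dK : 0 < delta / 2 / K.+1%:R by rewrite divr_gt0.
pose A N i := [set w | e / 2 <= `|N%:R^-1 * (\sum_(n < N) (fold (t i) (p n w)).1)
   - \int[mu]_q (fold (t i) q).1| ].
have : \forall N \near \oo, forall i : 'I_K, (P (A N i) <= (delta / 2 / K.+1%:R)%:E)%E.
  apply: filter_forall => i.
  exact: (weak_law p_indep p_law (integrable_fold_fst (t i)) e2 dK).
move=> [N1 _ HN1]; exists N1.+1 => // N /= N1N.
have N0 : (0 < N)%N by exact: leq_trans N1N.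
have N0' : 0 < N%:R :> R by rewrite ltr0n.
pose B := [set w | L <= N%:R^-1 * (\sum_(n < N) (1 + kale_radius (p n w)))].
have mB : measurable B.
  apply: measurable_superlevel; apply: measurable_funM => //.
  apply: measurable_sum => n.
  apply: (measurableT_comp (f := fun q => 1 + kale_radius q)) => //.
  by apply/measurable_EFinP; case/integrableP: integrable_1Dkale_radius.
have mA i : measurable (A N i).
  apply: measurable_superlevel; apply: measurableT_comp => //.
  apply: measurable_funB => //; apply: measurable_funM => //.
  exact: measurable_sum_fold_fst.
have PB : (P B <= (delta / 2)%:E)%E.
  apply: le_trans (markov_mean p_law integrable_1Dkale_radius _ L0 N0) _.
    by move=> q; rewrite addr_ge0// kale_radius_ge0.
  rewrite lee_fin -/C ler_pdivrMr// /L mulrCA divff ?mulr1 ?gt_eqF//.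
  by rewrite lerDr.
have mAA : measurable (\big[setU/set0]_(i < K) A N i).
  by apply: bigsetU_measurable => i _; exact: mA.
apply: le_trans (le_measure P _ _ _) _; rewrite ?inE.
- exact: measurableC (measurable_all_folded_le0 N).
- exact: measurableU mB mAA.
(* Off the exceptional events, the empirical moment at [theta] is at most that at [t i] plus
   [e / 2], which is below [- e + e / 2 + e / 2 = 0]. *)
- move=> w /= /existsNP[theta /negP]; rewrite -ltNge => Sw.
  apply: contrapT => /not_orP[/negP + Aw]; rewrite -ltNge => Bw.
  have [i iK ti] := tP theta.
  have Ai : `|N%:R^-1 * S N (t i) w - \int[mu]_q (fold (t i) q).1| < e / 2.
    rewrite ltNge; apply/negP => Ai; apply: Aw.
    by rewrite -bigcup_mkord; exists i.
  have := sticky (t i); rewrite /= => m_ti.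
  have := sum_fold_fst_dist_le alpha_gt N (fun n => p n w) theta (t i).
  rewrite -/(S N theta w) -/(S N (t i) w) => Sd.
  have {}Sd : N%:R^-1 * S N theta w <= N%:R^-1 * S N (t i) w + e / 2.
    rewrite -lerBlDl -mulrBr; apply: le_trans (_ : _ <= N%:R^-1 *
      (e / 2 / L * \sum_(n < N) (1 + kale_radius (p n w)))) _.
      rewrite ler_wpM2l ?invr_ge0 ?(ltW N0')//.
      apply: le_trans (ler_norm _) _; apply: le_trans Sd _.
      rewrite ler_wpM2r ?(ltW ti)// sumr_ge0// => n _.
      by rewrite addr_ge0// kale_radius_ge0.
    rewrite mulrCA -[leRHS](@divfK _ L) ?gt_eqF//.
    by rewrite ler_wpM2l ?ltW// divr_gt0.
  have : 0 < N%:R^-1 * S N theta w by rewrite mulr_gt0// invr_gt0.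
  by move: Ai; rewrite ltr_norml => /andP[_]; move: Sd m_ti; lra.
apply: le_trans (measureU2 _ mB mAA) _.
rewrite [delta]splitr EFinD; apply: leeD => //.
apply: le_trans (@Boole_inequality _ _ _ P (A N) K _) _ => //.
apply: (@le_trans _ _ (\sum_(i < K) (delta / 2 / K.+1%:R)%:E)%E).
  by apply: lee_sum => i _; apply: HN1; exact: ltnW.
rewrite sumEFin sumr_const card_ord -[_ *+ K]mulr_natr lee_fin mulrAC.
by rewrite ler_pdivrMr// ler_wpM2l ?(ltW d2)// ler_nat.
Qed.

End Sticky.

(** * Convergence of the rescaled barycenter laws to the Dirac mass *)

Theorem theorem1p13 (R : realType) (alpha : R) (alpha_gt : 2 * pi < alpha)
    (mu : probability (kale alpha) R)
    (mu_nondegenerate : nondegenerate_measure mu)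
    (mu_moment : (\int[mu]_q (kale_dist (apex alpha) q)%:E < +oo)%E)
    (d : measure_display) (Omega : measurableType d) (P : probability Omega R)
    (p : nat -> {RV P >-> kale alpha})
    (p_indep : mutually_independent P p)
    (p_law : forall (n : nat) (A : set (kale alpha)),
       measurable A -> distribution P (p n) A = mu A)
    (nu : nat -> probability (kale alpha) R)
    (nu_law : forall (N : nat) (U : set (kale alpha)),
       (0 < N)%N -> measurable U ->
       nu N U =
       P [set w | U (kale_scale (Num.sqrt N%:R) (barycenter N (fun n => p n w)))])
    (mu_sticky : fully_sticky mu) :
  [/\ tv_dist (nu N) \d_(apex alpha) @[N --> \oo] --> 0%E,
      forall phi : kale alpha -> R, continuous phi -> bounded_fun phi ->
        \int[nu N]_q phi q @[N --> \oo] --> phi (apex alpha) &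
      forall phi : kale alpha -> R, measurable_fun setT phi ->
        bounded_fun phi ->
        \int[nu N]_q phi q @[N --> \oo] --> phi (apex alpha)].
Proof.
have mapex := @measurable_apex R alpha.
have nu_apex N : (0 < N)%N -> nu N (~` [set apex alpha]) = P (~` [set w |
    forall theta, \sum_(n < N) (fold theta (p n w)).1 <= 0]).
  move=> N0; rewrite nu_law//; last exact: measurableC.
  have scaleE w : kale_scale (Num.sqrt N%:R) (barycenter N (fun n => p n w)) =
      apex alpha <-> forall theta, \sum_(n < N) (fold theta (p n w)).1 <= 0.
    apply: iff_trans (barycenter_apexP alpha_gt (fun n => p n w) N0).
    by apply: kale_scale_eq_apex; rewrite sqrtr_gt0 ltr0n.
  by congr (P _); apply/seteqP; split=> w nA Bw; apply: nA; exact/scaleE.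
have nu_far delta : 0 < delta ->
    \forall N \near \oo, (nu N (~` [set apex alpha]) <= delta%:E)%E.
  move=> delta0.
  have [K _ HK] := sticky_probability alpha_gt mu_moment p_indep p_law mu_sticky delta0.
  exists K.+1 => // N /= KN; rewrite nu_apex; last exact: leq_trans KN.
  by apply: HK; exact: ltnW.
have int_cvg (phi : kale alpha -> R) : measurable_fun setT phi -> bounded_fun phi ->
    \int[nu N]_q phi q @[N --> \oo] --> phi (apex alpha).
  (* [bounded_fun] only provides the bounds strictly above [M]; adding 1 also makes [B] positive. *)
  move=> mphi [M [_ phiM]]; pose B := `|M| + 1.
  have phiB q : `|phi q| <= B by apply: phiM => //; rewrite ltr_pwDr// ler_norm.
  have B0 : 0 < 2 * B by rewrite mulr_gt0// ltr_pwDr.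
  apply/cvgrPdist_le => e e0.
  have := nu_far _ (divr_gt0 e0 B0); apply: filterS => N nuN.
  apply: le_trans (Rintegral_point_mass_le (nu N) mapex mphi phiB) _.
  rewrite -ler_pdivlMl// mulrC -lee_fin fineK//.
  by apply: fin_num_measure; exact: measurableC.
split=> //; last first.
  by move=> phi /continuous_kale_measurable; exact: int_cvg.
have tv_le N := tv_dist_dirac_le (nu N) mapex.
have tv_ge0 N : (0 <= tv_dist (nu N) \d_(apex alpha))%E by exact: measure_ge0.
have tv_fin N : tv_dist (nu N) \d_(apex alpha) \is a fin_num.
  rewrite ge0_fin_numE//; apply: le_lt_trans (tv_le N) _.
  by rewrite lte_mul_pinfty// -ge0_fin_numE// fin_num_measure//; exact: measurableC.
apply/fine_cvgP; split; first exact: nearW.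
apply/cvgrPdist_le => e e0; have e2 : 0 < e / 2 by rewrite divr_gt0.
have := nu_far _ e2; apply: filterS => N nuN.
rewrite sub0r normrN ger0_norm ?fine_ge0// -lee_fin fineK//.
apply: le_trans (tv_le N) _; apply: (@le_trans _ _ (2%:E * (e / 2)%:E)%E).
  by rewrite lee_pmul2l.
by rewrite -EFinM mulrCA divff// mulr1.
Qed.
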